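(* Let $\mathcal X_{os}=IS_cP^+(\mathbf S_{os})$. Then for any $n\in\mathbb N$ (with $n\ge 1$), the poset $\mathcal X_{os}(\mathbf S_{os}^n,\mathbf S_{os})_J$ of join-irreducible elements of $\mathcal X_{os}(\mathbf S_{os}^n,\mathbf S_{os})$ is the $n$-dimensional hairy cube.
   Context: $S=\{0,h,1\}$ is the chain $0<h<1$. $r_2=S^2\setminus\{(h,0),(1,0)\}$. $\lambda_1$ is the binary partial operation on $S$ with domain $r_1=S^2\setminus\{(1,0)\}$ and graph (triples $(x,y,\lambda_1(x,y))$) $\{(0,0,0),(h,h,h),(1,1,1),(0,h,h),(0,1,h),(h,0,0),(h,1,h),(1,h,1)\}$. $\mathbf S_{os}=\langle S;\{r_2\},\{\lambda_1\},\mathcal T\rangle$ with $\mathcal T$ discrete. $IS_cP^+(\mathbf S_{os})$ is the category of isomorphic copies of closed substructures of non-empty powers of $\mathbf S_{os}$ (relations and partial operations coordinatewise), with continuous structure-preserving maps. In particular $\mathcal X_{os}(\mathbf S_{os}^n,\mathbf S_{os})$ is the set of maps $f:S^n\to S$ such that, for $x,y\in S^n$: if $(x_i,y_i)\in r_2$ for all $i$ then $(f(x),f(y))\in r_2$; and if $(x_i,y_i)\in r_1$ for all $i$ then $(f(x),f(y))\in r_1$ and $f(\lambda_1(x,y))=\lambda_1(f(x),f(y))$, with $\lambda_1(x,y)$ computed coordinatewise. It is a lattice under pointwise operations; $f$ is join-irreducible if $f\ne 0$ and $f=g\vee k$ with $g,k$ in the lattice implies $f=g$ or $f=k$; join-irreducibles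 carry the pointwise order. The $n$-dimensional hairy cube is the poset (unique up to isomorphism) consisting of a base isomorphic to $2^n$ (the $n$-th power of the two-element chain), which is a downset, together with pairwise incomparable hairs, such that each base element is covered by a unique hair and each hair covers a unique base element. Here the base consists of the join-irreducible elements that are $\le$ the constant map $h$. *)

(* Defs.v *)
From HB Require Import structures.
From mathcomp Require Import all_boot all_order.

Set Implicit Arguments.
Unset Strict Implicit.
Unset Printing Implicit Defensive.

Import Order.TTheory.
Local Open Scope order_scope.

(* Finite discrete structures with one binary relation and one binary partial
   operation; [op] is only meaningful on pairs satisfying [dom].  A finite
   power of a discrete space is discrete, so every map between such structures
   is continuous and the topology is left implicit. *)
Record structure := Structure {
  carrier :> finType;
  rel2 : rel carrier;
  dom : rel carrier;
  op : carrier -> carrier -> carrier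
}.

Definition power (M : structure) (n : nat) : structure :=
  @Structure {ffun 'I_n -> M}
    (fun x y => [forall i, rel2 (x i) (y i)])
    (fun x y => [forall i, dom (x i) (y i)])
    (fun x y => [ffun i => op (x i) (y i)]).

Definition preserves_rel (M N : structure) (f : M -> N) : bool :=
  [forall x, forall y, rel2 x y ==> rel2 (f x) (f y)].

Definition preserves_op (M N : structure) (f : M -> N) : bool :=
  [forall x, forall y, dom x y ==>
     dom (f x) (f y) && (f (op x y) == op (f x) (f y))].

Definition is_morphism (M N : structure) (f : M -> N) : bool :=
  preserves_rel f && preserves_op f.

Variant S3 : predArgType := s0 | sh | s1.

Definition S3_code (x : S3) : 'I_3 :=
  match x with
  | s0 => @Ordinal 3 0 isT | sh => @Ordinal 3 1 isT | s1 => @Ordinal 3 2 isT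
  end.

Definition S3_decode (i : 'I_3) : S3 :=
  match val i with 0%N => s0 | 1%N => sh | _ => s1 end.

Lemma S3_codeK : cancel S3_code S3_decode.
Proof. by case. Qed.

HB.instance Definition _ := Finite.copy S3 (can_type S3_codeK).

(* The chain 0 < h < 1. *)
Definition S3_le (x y : S3) : bool :=
  match x, y with
  | s0, _ | sh, sh | sh, s1 | s1, s1 => true
  | _, _ => false
  end.

Definition S3_lt (x y : S3) : bool := (y != x) && S3_le x y.
Definition S3_meet (x y : S3) : S3 := if S3_lt x y then x else y.
Definition S3_join (x y : S3) : S3 := if S3_lt x y then y else x.

Fact S3_le_anti : antisymmetric S3_le.
Proof. by case; case. Qed.
Fact S3_le_trans : transitive S3_le.
Proof. by case; case; case. Qed.
Fact S3_le_total : total S3_le.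
Proof. by case; case. Qed.

Fact S3_display : Order.disp_t.
Proof. exact: (Order.Disp tt tt). Qed.

HB.instance Definition _ := @Order.isOrder.Build S3_display S3
  S3_le S3_lt S3_meet S3_join
  (fun _ _ => erefl) (fun _ _ => erefl) (fun _ _ => erefl)
  S3_le_anti S3_le_trans S3_le_total.

Definition r2 : rel S3 :=
  fun x y => (x, y) \notin [:: (sh, s0); (s1, s0)].

Definition r1 : rel S3 := fun x y => (x, y) != (s1, s0).

(* The value at (1, 0), which is outside the domain r1, is never used. *)
Definition lambda1 (x y : S3) : S3 :=
  match x, y with
  | s0, s0 => s0 | sh, sh => sh | s1, s1 => s1 | s0, sh => sh
  | s0, s1 => sh | sh, s0 => s0 | sh, s1 => sh | s1, sh => s1
  | s1, s0 => s0
  end.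

Definition S_os : structure := @Structure S3 r2 r1 lambda1.

(* The hom-set X_os(X, S_os), ordered pointwise. *)
Record Xos (X : structure) : predArgType := MkXos {
  Xos_fun :> {ffun X -> S3};
  Xos_morphism : @is_morphism X S_os Xos_fun
}.

HB.instance Definition _ (X : structure) := [isSub for @Xos_fun X].
HB.instance Definition _ (X : structure) := [Finite of Xos X by <:].

Section XosLattice.
Variable X : structure.
Implicit Types f g : Xos X.

Definition Xos_le f g : bool := [forall x, f x <= g x].

Fact Xos_le_refl : reflexive Xos_le.
Proof. by move=> f; apply/forallP. Qed.

Fact Xos_le_anti : antisymmetric Xos_le.
Proof.
move=> f g /andP[/forallP fg /forallP gf]; apply/val_inj/ffunP => x.
by apply/le_anti; rewrite fg gf.
Qed.

Fact Xos_le_trans : transitive Xos_le.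
Proof.
move=> g f k /forallP fg /forallP gk; apply/forallP => x.
exact: le_trans (fg x) (gk x).
Qed.

Fact Xos_display : Order.disp_t.
Proof. exact: (Order.Disp tt tt). Qed.

HB.instance Definition _ := @Order.Le_isPOrder.Build Xos_display (Xos X)
  Xos_le Xos_le_refl Xos_le_anti Xos_le_trans.

Fact Xos_pointwise_morphism (o : S3 -> S3 -> S3) (f g : Xos X) :
    (forall a b c d, r2 a b -> r2 c d -> r2 (o a c) (o b d)) ->
    (forall a b c d, r1 a b -> r1 c d ->
       r1 (o a c) (o b d) &&
       (o (lambda1 a b) (lambda1 c d) == lambda1 (o a c) (o b d))) ->
  @is_morphism X S_os [ffun x => o (f x) (g x)].
Proof.
move=> o2 o1; case: f g => [f /andP[f2 f1]] [g /andP[g2 g1]] /=.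
apply/andP; split; apply/forallP => x; apply/forallP => y; apply/implyP => xy.
  move/forallP/(_ x)/forallP/(_ y)/implyP/(_ xy): f2 => f2.
  move/forallP/(_ x)/forallP/(_ y)/implyP/(_ xy): g2 => g2.
  by rewrite !ffunE; apply: o2.
move/forallP/(_ x)/forallP/(_ y)/implyP/(_ xy): f1 => /andP[f1 /eqP fE].
move/forallP/(_ x)/forallP/(_ y)/implyP/(_ xy): g1 => /andP[g1 /eqP gE].
by rewrite !ffunE fE gE; apply: o1.
Qed.

Fact Xos_meet_morphism f g :
  @is_morphism X S_os [ffun x => f x `&` g x].
Proof.
apply: (Xos_pointwise_morphism (o := fun a b : S3 => a `&` b)).
  by case; case; case; case.
by case; case; case; case.
Qed.

Fact Xos_join_morphism f g :
  @is_morphism X S_os [ffun x => f x `|` g x].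
Proof.
apply: (Xos_pointwise_morphism (o := fun a b : S3 => a `|` b)).
  by case; case; case; case.
by case; case; case; case.
Qed.

Definition Xos_meet f g : Xos X := MkXos (Xos_meet_morphism f g).
Definition Xos_join f g : Xos X := MkXos (Xos_join_morphism f g).

Fact Xos_meetP f g k : (f <= Xos_meet g k) = (f <= g) && (f <= k).
Proof.
apply/forallP/andP => [H|[/forallP fg /forallP fk] x]; last first.
  by rewrite ffunE lexI fg fk.
by split; apply/forallP => x; have := H x; rewrite ffunE lexI => /andP[].
Qed.

Fact Xos_joinP f g k : (Xos_join f g <= k) = (f <= k) && (g <= k).
Proof.
apply/forallP/andP => [H|[/forallP fk /forallP gk] x]; last first.
  by rewrite ffunE leUx fk gk.
by split; apply/forallP => x; have := H x; rewrite ffunE leUx => /andP[].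
Qed.

HB.instance Definition _ := @Order.POrder_MeetJoin_isLattice.Build
  Xos_display (Xos X) Xos_meet Xos_join Xos_meetP Xos_joinP.

Fact Xos_cst_morphism (c : S3) : @is_morphism X S_os [ffun=> c].
Proof.
apply/andP; split; apply/forallP => x; apply/forallP => y; apply/implyP => _.
  by rewrite !ffunE; case: c.
by rewrite !ffunE; case: c.
Qed.

Definition Xos_cst (c : S3) : Xos X := MkXos (Xos_cst_morphism c).

Fact Xos_le0x f : Xos_cst s0 <= f.
Proof. by apply/forallP => x; rewrite ffunE. Qed.

Fact Xos_lex1 f : f <= Xos_cst s1.
Proof. by apply/forallP => x; rewrite ffunE; case: (f x). Qed.

HB.instance Definition _ := @Order.hasBottom.Build Xos_display (Xos X)
  (Xos_cst s0) Xos_le0x.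
HB.instance Definition _ := @Order.hasTop.Build Xos_display (Xos X)
  (Xos_cst s1) Xos_lex1.

End XosLattice.

Definition join_irreducible d (L : finTBLatticeType d) (x : L) : bool :=
  (x != \bot) &&
  [forall y, forall z, (x == y `|` z) ==> (x == y) || (x == z)].

(* The poset of join-irreducible elements, with the order inherited from L. *)
Record JI d (L : finTBLatticeType d) : predArgType := MkJI {
  JI_elt : L;
  JI_irreducible : join_irreducible JI_elt
}.

HB.instance Definition _ d (L : finTBLatticeType d) := [isSub for @JI_elt d L].
HB.instance Definition _ d (L : finTBLatticeType d) := [Finite of JI L by <:].
HB.instance Definition _ d (L : finTBLatticeType d) :=
  [SubChoice_isSubPOrder of JI L by <: with d].

(* q covers p. *)
Definition covers d (P : porderType d) (q p : P) : Prop :=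
  p < q /\ forall r : P, ~ (p < r /\ r < q).

(* P, with the elements of [base] as its base and the others as its hairs, is
   the n-dimensional hairy cube; [n.-tupleprod bool] is 2^n with the product
   order. *)
Definition hairy_cube (n : nat) d (P : finPOrderType d) (base : pred P) : Prop :=
  [/\ forall p q : P, p <= q -> base q -> base p,
      exists2 phi : n.-tupleprod bool -> P,
        {mono phi : x y / x <= y} & forall p : P, base p <-> exists x, phi x = p,
      forall p q : P, ~~ base p -> ~~ base q -> p <= q -> p = q,
      forall b : P, base b -> exists! a : P, ~~ base a /\ covers a b &
      forall a : P, ~~ base a -> exists! b : P, base b /\ covers a b].

Definition below_h (X : structure) (f : JI (Xos X)) : bool :=
  JI_elt f <= Xos_cst X sh.

(* Main.v *)
Require Import Defs.
From HB Require Import structures.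
From mathcomp Require Import all_boot all_order.

(** Encode x in S^n by the sets nz x = {i | x_i <> 0} and top x = {i | x_i = 1},
    so that top x \subset nz x.  On these codes r2 is inclusion of the nz-parts,
    and lambda1 x y has the nz-part of y and the top-part of x.  A morphism
    f : S^n -> S is therefore a pair consisting of an upset U of 2^n and an
    arbitrary subset V of U, with f x <> 0 iff nz x is in U and f x = 1 iff
    top x is in V.  The join-irreducible pairs are (up p, {}), forming the base,
    and (up p, {p}), forming the hairs. *)

Set Implicit Arguments.
Unset Strict Implicit.
Unset Printing Implicit Defensive.

Import Order.TTheory.
Local Open Scope order_scope.

Lemma join_irreducible_bigjoin d (L : finTBLatticeType d) (I : finType)
    (P : pred I) (F : I -> L) (x : L) :
  join_irreducible x -> x = \join_(i | P i) F i -> exists2 i, P i & x = F i.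
Proof.
case/andP=> x0 /forallP xJ xE.
(* The equation is split into two inequalities so that the induction can run over partial joins:
   these stay below [x], and [x] lies below the remaining join as long as no term equals it. *)
suff: x <= \join_(i | P i) F i -> exists2 i, P i & x = F i.
  by rewrite -xE; apply.
have {xE}: \join_(i | P i) F i <= x by rewrite -xE.
elim/big_rec: _ => [|i y Pi IH]; first by rewrite lex0 (negPf x0).
rewrite leUx => /andP[Fx yx] xle.
have xE : x == F i `|` y by rewrite eq_le xle leUx Fx yx.
have /forallP/(_ y)/implyP/(_ xE)/orP[/eqP ->|/eqP xy] := xJ (F i).
  by exists i.
by apply: IH; rewrite -?xy.
Qed.

Section Generators.
Variable n : nat.
Local Notation Sn := (power S_os n).
Local Notation L := (Xos Sn).
Implicit Types (x y : Sn) (f : L) (p q : {set 'I_n}) (c : bool).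

Definition nz x : {set 'I_n} := [set i | (x : {ffun _ -> S3}) i != s0].
Definition top x : {set 'I_n} := [set i | (x : {ffun _ -> S3}) i == s1].

Lemma rel2E x y : rel2 x y = (nz x \subset nz y).
Proof.
apply/forallP/subsetP => [H i|H i].
  by rewrite !inE; move: (H i) => /=; case: (_ i); case: (_ i).
by move: (H i); rewrite !inE /=; case: (_ i); case: (_ i) => // /(_ isT).
Qed.

Lemma domE x y : dom x y = (top x \subset nz y).
Proof.
apply/forallP/subsetP => [H i|H i].
  by rewrite !inE; move: (H i) => /=; case: (_ i); case: (_ i).
by move: (H i); rewrite !inE /=; case: (_ i); case: (_ i) => // /(_ isT).
Qed.

Lemma top_nz x : top x \subset nz x.
Proof. by apply/subsetP => i; rewrite !inE => /eqP ->. Qed.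

Lemma nz_op x y : dom x y -> nz (op x y) = nz y.
Proof.
move=> /forallP H; apply/setP => i; rewrite !inE /= ffunE.
by move: (H i) => /=; case: (_ i); case: (_ i).
Qed.

Lemma top_op x y : dom x y -> top (op x y) = top x.
Proof.
move=> /forallP H; apply/setP => i; rewrite !inE /= ffunE.
by move: (H i) => /=; case: (_ i); case: (_ i).
Qed.

Lemma nz_mono f x y : nz x \subset nz y -> f x != s0 -> f y != s0.
Proof.
rewrite -rel2E => xy.
case/andP: (Xos_morphism f) => /forallP/(_ x)/forallP/(_ y).
by rewrite xy /= => + _; case: (f x); case: (f y).
Qed.

(** With equal top-parts, [op x y] is [y], so [f y = lambda1 s1 (f y)]. Since [(s1, s0)] is outside
    [r1] and [lambda1 s1 sh] is [s1], only [f y = s1] remains. *)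
Lemma morph_top f x y : top x = top y -> f x = s1 -> f y = s1.
Proof.
move=> xy fx; case/andP: (Xos_morphism f) => _ /forallP fop.
have /andP[dxy dyy] : dom x y && dom y y by rewrite !domE xy top_nz.
have opE : op x y = y.
  apply/ffunP => i; move/setP/(_ i): xy; move/forallP/(_ i): dxy.
  by rewrite !inE /= ffunE; case: (_ i); case: (_ i).
have := fop x; move/forallP/(_ y); rewrite dxy opE fx /= => /andP[].
by case: (f y).
Qed.

Definition gen_val c : S3 := if c then s1 else sh.

(** This is the pair (up p, {}) for [c] false and (up p, {p}) for [c] true. *)
Definition gen_fun c p x : S3 :=
  if c && (top x == p) then s1 else if p \subset nz x then sh else s0.

Lemma gen_fun_nz c p x : (gen_fun c p x != s0) = (p \subset nz x).
Proof.
rewrite /gen_fun; case: ifP => [/andP[_ /eqP <-]|_]; first by rewrite top_nz.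
by case: ifP.
Qed.

Lemma gen_fun_top c p x : (gen_fun c p x == s1) = c && (top x == p).
Proof. by rewrite /gen_fun; case: ifP => // _; case: ifP. Qed.

Fact gen_morphism c p : @is_morphism Sn S_os [ffun x => gen_fun c p x].
Proof.
apply/andP; split; apply/forallP => x; apply/forallP => y; apply/implyP => xy.
  move: xy; rewrite rel2E !ffunE => xy.
  have := gen_fun_nz c p x; have := gen_fun_nz c p y.
  case: (boolP (p \subset nz x)) => [px|_].
    by rewrite (subset_trans px xy); case: gen_fun; case: gen_fun.
  by case: (gen_fun c p x); case: gen_fun.
have := gen_fun_nz c p (op x y); have := gen_fun_top c p (op x y).
rewrite nz_op // top_op // -(gen_fun_nz c) -gen_fun_top !ffunE.
move: xy; rewrite domE => xy.
(* The values stay in [r1]: at value 1 the set [p] is the top-part of [x], which the domain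
   condition puts inside [nz y]. *)
have : gen_fun c p x == s1 -> gen_fun c p y != s0.
  by rewrite gen_fun_top gen_fun_nz => /andP[_ /eqP <-].
by case: (gen_fun c p x); case: (gen_fun c p y); case: gen_fun => //= _ _ ->.
Qed.

Definition gen c p : L := MkXos (gen_morphism c p).

(** A test point: evaluating a morphism here decides whether it lies above [gen c p]. *)
Definition gen_pt c p : Sn := [ffun i => if i \in p then gen_val c else s0].

Lemma nz_gen_pt c p : nz (gen_pt c p) = p.
Proof. by apply/setP => i; rewrite inE ffunE; case: c; case: ifP. Qed.

Lemma top_gen_pt p : top (gen_pt true p) = p.
Proof. by apply/setP => i; rewrite inE ffunE; case: ifP. Qed.

Lemma gen_at_pt c p : gen c p (gen_pt c p) = gen_val c.
Proof.
by rewrite ffunE /gen_fun nz_gen_pt subxx; case: c; rewrite //= top_gen_pt eqxx.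
Qed.

(** One point suffices because values spread: 1 to all points with the same top-part by [morph_top],
    and being nonzero to all points with a larger nz-part by [nz_mono]. *)
Lemma gen_leE c p f : (gen c p <= f) = (gen_val c <= f (gen_pt c p)).
Proof.
apply/idP/idP => [/forallP/(_ (gen_pt c p))|fc]; first by rewrite gen_at_pt.
apply/forallP => x; rewrite ffunE /gen_fun; case: ifP => [/andP[cT /eqP xp]|_].
  rewrite (morph_top (x := gen_pt c p)) ?cT ?top_gen_pt //.
  by move: fc; rewrite cT; case: (f _).
case: ifP => [px|_]; last by case: (f x).
have : f x != s0.
  apply: (nz_mono (x := gen_pt c p)); first by rewrite nz_gen_pt.
  by case: (c) fc; case: (f _).
by case: (f x).
Qed.

Lemma gen_le_gen c p c' q :
  (gen c p <= gen c' q) = if c then c' && (p == q) else q \subset p.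
Proof.
rewrite gen_leE ffunE; case: c.
  by rewrite -{2}(top_gen_pt p) -gen_fun_top; case: gen_fun.
by rewrite -{2}(nz_gen_pt false p) -(gen_fun_nz c'); case: gen_fun.
Qed.

(** By [gen_leE], lying above [gen c p] is a lower bound on one value in the chain S, so a join lies
    above it only if one of the joinands does. *)
Lemma gen_ji c p : join_irreducible (gen c p).
Proof.
apply/andP; split.
  apply/eqP => gE; have := gen_at_pt c p.
  by rewrite gE ffunE; case: c {gE}.
apply/forallP => y; apply/forallP => z; apply/implyP => /eqP gE.
have yg : y <= gen c p by rewrite gE leUl.
have zg : z <= gen c p by rewrite gE leUr.
rewrite !eq_le yg zg !andbT !gen_leE -lexU.
by rewrite -(gen_at_pt c p) gE ffunE.
Qed.

Lemma ji_gen f : join_irreducible f -> exists c p, f = gen c p.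
Proof.
(* Every morphism is the join of the generators below it: at [x], value h is attained by
   [gen false (nz x)] and value 1 by [gen true (top x)]. *)
move=> fJ; suff fE : f = \join_(i | gen i.1 i.2 <= f) gen i.1 i.2.
  by have [[c p] _ ->] := join_irreducible_bigjoin fJ fE; exists c, p.
apply/le_anti/andP; split; last exact/joinsP.
set g := \join_(i | _) _.
have gle c p : gen c p <= f -> gen c p <= g.
  by move=> cp; exact: (joins_sup (j := (c, p))).
apply/forallP => x; case fx: (f x); first by case: (g x).
  have /gle/forallP/(_ x) : gen false (nz x) <= f.
    rewrite gen_leE; have : f (gen_pt false (nz x)) != s0.
      by apply: (nz_mono (x := x)); rewrite ?nz_gen_pt ?fx.
    by case: (f _).
  by rewrite ffunE /gen_fun subxx.
have /gle/forallP/(_ x) : gen true (top x) <= f.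
  by rewrite gen_leE (morph_top (x := x)) ?top_gen_pt.
by rewrite ffunE /gen_fun eqxx.
Qed.

Definition genJ c p : JI L := MkJI (gen_ji c p).

Lemma genJ_surj (f : JI L) : exists c p, f = genJ c p.
Proof.
have [c [p fE]] := ji_gen (JI_irreducible f).
by exists c, p; apply/val_inj.
Qed.

Lemma genJ_le c p c' q :
  (genJ c p <= genJ c' q) = if c then c' && (p == q) else q \subset p.
Proof. exact: gen_le_gen. Qed.

Lemma genJ_inj c p c' q : genJ c p = genJ c' q -> c = c' /\ p = q.
Proof.
move=> /eqP; rewrite eq_le !genJ_le; case: c; case: c' => //=.
- by case/andP => /eqP.
- by rewrite andbF.
- by move=> qp; split=> //; apply/eqP; rewrite eqEsubset andbC.
Qed.

Lemma below_h_genJ c p : below_h (genJ c p) = ~~ c.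
Proof. by rewrite /below_h gen_leE ffunE; case: c. Qed.

Lemma genJ_covers p q : covers (genJ true p) (genJ false q) <-> p = q.
Proof.
split=> [[/ltW qp noz]|->].
  (* For distinct [p] and [q], the base element [genJ false p] lies strictly between the two. *)
  apply/eqP/negPn/negP => npq; apply: (noz (genJ false p)).
  move: qp; rewrite !lt_neqAle !genJ_le subxx => ->; rewrite !andbT.
  by split; apply/eqP => /genJ_inj[] // _ qE; rewrite qE eqxx in npq.
split=> [|r []].
  by rewrite lt_neqAle genJ_le subxx andbT; apply/eqP => /genJ_inj[].
have [[] [r' ->]] := genJ_surj r; rewrite !lt_neqAle !genJ_le.
  by move=> _ /andP[/eqP ne /eqP rE]; rewrite rE in ne.
move=> /andP[/eqP ne rq] /andP[_ qr]; case: ne; congr genJ.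
by apply/eqP; rewrite eqEsubset rq qr.
Qed.

End Generators.

Theorem corollary6 (n : nat) (hn : (1 <= n)%N) :
  @hairy_cube n _ (JI (Xos (power S_os n))) (@below_h (power S_os n)).
Proof.
split.
- by move=> f g fg; apply: (le_trans (y := JI_elt g)).
(* The base is ordered by reverse inclusion of [p], hence the complement. *)
- exists (fun t => genJ false [set i | ~~ tnth t i]).
    move=> s t; rewrite genJ_le leEtprod.
    apply/subsetP/forallP => H i; have := H i; rewrite !inE.
      by case: (tnth s i); case: (tnth t i) => // /(_ isT).
    by case: (tnth s i); case: (tnth t i).
  move=> f; split=> [|[t <-]]; last by rewrite below_h_genJ.
  have [c [p ->]] := genJ_surj f; rewrite below_h_genJ => /negPf ->.
  exists [tuple i \notin p | i < n]; congr genJ.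
  by apply/setP => i; rewrite inE tnth_mktuple negbK.
- move=> f g; have [c [p ->]] := genJ_surj f; have [c' [q ->]] := genJ_surj g.
  rewrite !below_h_genJ !negbK => -> ->.
  by rewrite genJ_le /= => /eqP ->.
- move=> b; have [c [p ->]] := genJ_surj b; rewrite below_h_genJ => /negPf ->.
  exists (genJ true p); split.
    by rewrite below_h_genJ; split=> //; apply/genJ_covers.
  move=> a; have [c' [q ->]] := genJ_surj a.
  by rewrite below_h_genJ negbK => -[-> /genJ_covers ->].
move=> a; have [c [p ->]] := genJ_surj a; rewrite below_h_genJ negbK => ->.
exists (genJ false p); split.
  by rewrite below_h_genJ; split=> //; apply/genJ_covers.
move=> b; have [c' [q ->]] := genJ_surj b.
by rewrite below_h_genJ => -[/negPf -> /genJ_covers ->].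
Qed.
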